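(* Let $\mathbf{K}=\{\mathbf{x}\in\mathbb{R}^n: g_j(\mathbf{x})\ge0,\ j=1,\ldots,m\}$ be compact with positive Lebesgue measure, where $g_1,\ldots,g_m\in\mathbb{R}[\mathbf{x}]$, and let $\mathbf{y}=(y_\alpha)_{\alpha\in\mathbb{N}^n}$ be a real sequence with $y_0=1$. Let $\lambda$ be the Lebesgue measure on $\mathbf{K}$ scaled to be a probability measure, and $\gamma_\alpha:=\int_{\mathbf{K}}\mathbf{x}^\alpha\,\lambda(d\mathbf{x})$ for $\alpha\in\mathbb{N}^n$. Let $d\in\mathbb{N}$ and consider the semidefinite program, in the unknown $\mathbf{z}=(z_{\alpha k})_{(\alpha,k)\in\mathbb{N}^{n+1}_{2d}}$, $$\begin{array}{rl}\displaystyle\min_{\mathbf{z}}&\mathrm{trace}(\mathbf{M}_d(\mathbf{z}))\\ \text{s.t.}&\mathbf{M}_d(\mathbf{z})\succeq0,\\ &\mathbf{M}_{d-v_\beta}(g^\beta\,\mathbf{z})\succeq0,\quad\beta\in\{0,1\}^m\ \text{with}\ v_\beta\le d,\\ &z_{\alpha0}=\gamma_\alpha,\quad\alpha\in\mathbb{N}^n_{2d},\\ &z_{\alpha1}=y_\alpha,\quad(\alpha,1)\in\mathbb{N}^{n+1}_{2d},\end{array}$$ where $g^\beta:=g_1^{\beta_1}\cdots g_m^{\beta_m}$ and $v_\beta:=\lceil(\deg g^\beta)/2\rceil$. If this semidefinite program has no solution (i.e., no $\mathbf{z}$ satisfies its constraints), then $\mathbf{y}$ cannot have a representing finite Borel measure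 on $\mathbf{K}$ with a density in $L_p(\mathbf{K})$, for any $p\ge 2d$.
   Context: $\mathbb{N}=\{0,1,2,\ldots\}$. For $\alpha\in\mathbb{N}^n$, $\mathbf{x}^\alpha=x_1^{\alpha_1}\cdots x_n^{\alpha_n}$. For $r\in\mathbb{N}$ let $\mathbb{N}^r_d=\{\beta\in\mathbb{N}^r:\sum_j\beta_j\le d\}$; an element of $\mathbb{N}^{n+1}$ is written $(\alpha,k)$ with $\alpha\in\mathbb{N}^n$, $k\in\mathbb{N}$. For $\mathbf{z}=(z_{\alpha k})$, with indices regarded as elements of $\mathbb{N}^{n+1}$, the moment matrix $\mathbf{M}_d(\mathbf{z})$ is the real symmetric matrix indexed by $\mathbb{N}^{n+1}_d$ with $(\alpha,\beta)$ entry $z_{\alpha+\beta}$ ($\alpha,\beta\in\mathbb{N}^{n+1}_d$). For a polynomial $g(\mathbf{x},t)=\sum_{\gamma\in\mathbb{N}^{n+1}}g_\gamma(\mathbf{x},t)^\gamma$ in $\mathbb{R}[\mathbf{x},t]$ ($t$ a single extra variable), the localizing matrix $\mathbf{M}_d(g\,\mathbf{z})$ is the real symmetric matrix indexed by $\mathbb{N}^{n+1}_d$ with $(\alpha,\beta)$ entry $\sum_\gamma g_\gamma z_{\alpha+\beta+\gamma}$. Polynomials $g^\beta\in\mathbb{R}[\mathbf{x}]$ are viewed as elements of $\mathbb{R}[\mathbf{x},t]$ not depending on $t$. $A\succeq0$ means $A$ is positive semidefinite. A sequence $\mathbf{y}$ has a representing measure $\mu$ on $\mathbf{K}$ if $\mu$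 is a finite (positive) Borel measure supported on $\mathbf{K}$ with $y_\alpha=\int_{\mathbf{K}}\mathbf{x}^\alpha\,d\mu$ for all $\alpha\in\mathbb{N}^n$. $L_p(\mathbf{K})$, $1\le p<\infty$, is the Lebesgue space with respect to $\lambda$; densities are with respect to $\lambda$. *)

(* Defs.v *)
From HB Require Import structures.
From mathcomp Require Import all_boot all_order all_algebra.
From mathcomp.multinomials Require Import -(notations) mpoly.
From mathcomp Require Import all_classical all_reals all_analysis measurable_realfun.
Set Implicit Arguments.
Unset Strict Implicit.
Unset Printing Implicit Defensive.
Import Order.TTheory GRing.Theory Num.Theory numFieldNormedType.Exports.
Local Open Scope classical_set_scope.
Local Open Scope ring_scope.

(* Points of R^n are n.-tuple R: MathComp-Analysis gives tuples the sigma-algebra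
   generated by the coordinates, which on R^n is the Borel sigma-algebra. *)

Section lebesgue_tuple.
Variable R : realType.

Definition tuple_cons n (xt : measurableTypeR R * n.-tuple R) : n.+1.-tuple R :=
  [tuple of xt.1 :: xt.2].

Lemma measurable_tuple_cons n : measurable_fun [set: _] (@tuple_cons n).
Proof. by apply: measurable_cons; [exact: measurable_fst|exact: measurable_snd]. Qed.

Section succ.
Local Open Scope ereal_scope.
Variables (n : nat) (mu : {sigma_finite_measure set (n.-tuple R) -> \bar R}).

Definition lebesgue_cons : set (n.+1.-tuple R) -> \bar R :=
  pushforward (lebesgue_measure \x mu) (@tuple_cons n).

Let lebesgue_cons_measure : {measure set (n.+1.-tuple R) -> \bar R} :=
  @measure_function_pushforward__canonical__measure_function_Measure
    _ _ _ _ _ (lebesgue_measure \x mu)%E _ (@measurable_tuple_cons n).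

HB.instance Definition _ := Measure.copy lebesgue_cons lebesgue_cons_measure.

Let lebesgue_cons_sigma_finite : sigma_finite setT lebesgue_cons.
Proof.
have /sigma_finiteP[F [TF ndF Foo]] := sigma_finiteT (@lebesgue_measure R).
have /sigma_finiteP[G [TG ndG Goo]] := sigma_finiteT mu.
exists (fun k => [set t | F k (thead t) /\ G k [tuple of behead t]]).
  apply/seteqP; split=> // t _.
  have : setT (thead t : measurableTypeR R) by [].
  have : setT [tuple of behead t] by [].
  rewrite TF TG => -[k _ Gk] [l _ Fl]; exists (maxn k l) => //; split.
    by move: (thead t) Fl; exact/subsetPset/ndF/leq_maxr.
  by move: Gk; move: [tuple of behead t]; exact/subsetPset/ndG/leq_maxl.
move=> k; have [mF Fkoo] := Foo k; have [mG Gkoo] := Goo k; split.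
  rewrite [X in measurable X](_ : _ =
      (@tnth n.+1 R ^~ ord0) @^-1` F k `&`
      (fun t : n.+1.-tuple R => [tuple of behead t]) @^-1` G k)//.
  by apply: measurableI; rewrite -[X in measurable X]setTI;
    [exact: measurable_tnth|exact: measurable_behead].
rewrite /lebesgue_cons /pushforward /= (_ : _ @^-1` _ = F k `*` G k).
  by rewrite product_measure1E// lte_mul_pinfty// ge0_fin_numE.
have tE x (t : n.-tuple R) : [tuple of behead (tuple_cons (x, t))] = t.
  exact: val_inj.
by apply/seteqP; split=> -[x t] /=; rewrite tE theadE.
Qed.

HB.instance Definition _ := Measure_isSigmaFinite.Build _ _ _ lebesgue_cons
  lebesgue_cons_sigma_finite.

End succ.

(* Lebesgue measure on R^n, as an iterated product measure. *)
Fixpoint lebesgue_tuple (n : nat) : {sigma_finite_measure set (n.-tuple R) -> \bar R} :=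
  match n with
  | 0 => dirac [tuple]
  | n'.+1 => lebesgue_cons (lebesgue_tuple n')
  end.

Lemma lebesgue_tuple_box n (A : 'I_n -> set R) : (forall i, measurable (A i)) ->
  lebesgue_tuple n [set x | forall i, A i (tnth x i)] =
    (\prod_(i < n) (lebesgue_measure (A i)))%E.
Proof.
elim: n A => [A _|n IH A mA] /=.
  rewrite big_ord0 diracE mem_set//=; by case.
rewrite big_ord_recl /= -IH//.
rewrite /lebesgue_cons /pushforward -product_measure1E//=.
- congr (product_measure1 _ _ _); apply/seteqP; split=> -[x t] /=.
    move=> At; split; first exact: (At ord0).
    by move=> i; have := At (lift ord0 i); rewrite tnthS.
  move=> [Ax At] i; have [j ->|->//] := unliftP ord0 i.
  by rewrite tnthS; exact: At.
- exact: mA.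
- rewrite (_ : mkset _ = \bigcap_(i : 'I_n) ((@tnth n R ^~ i) @^-1` A (lift ord0 i))).
    apply: fin_bigcap_measurable => // i _.
    by rewrite -[X in measurable X]setTI; apply: measurable_tnth => //; exact: mA.
  by apply/seteqP; split=> t /= h i => [_|]; exact: h.
Qed.

End lebesgue_tuple.

Definition row_of_tuple (R : Type) n (x : n.-tuple R) : 'rV[R]_n :=
  \row_i tnth x i.

Definition monomial (R : realType) n (a : multinom n) (x : n.-tuple R) : R :=
  \prod_(i < n) tnth x i ^+ a i.

Section basic_semialgebraic.
Variables (R : realType) (n m : nat) (g : 'I_m -> mpoly n R).

Definition semialg_set : set (n.-tuple R) :=
  [set x | forall j, 0 <= meval (tnth x) (g j)].

Lemma measurable_meval (p : mpoly n R) :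
  measurable_fun [set: n.-tuple R] (fun x => meval (tnth x) p).
Proof.
apply: measurable_sum => a; apply: measurable_funM => //.
by apply: measurable_prod => i _; apply: measurable_funX; exact: measurable_tnth.
Qed.

Lemma measurable_semialg_set : measurable semialg_set.
Proof.
rewrite (_ : semialg_set =
    \bigcap_(j : 'I_m) ((fun x => meval (tnth x) (g j)) @^-1` `[0, +oo[)).
  apply: fin_bigcap_measurable => // j _.
  by rewrite -[X in measurable X]setTI; apply: measurable_meval.
apply/seteqP; split=> x /= h j => [_|]; last have := h j I;
  by rewrite /= in_itv/= andbT.
Qed.

(* When the set has Lebesgue measure 0 or +oo, mnormalize defaults to its last
   argument; the choice of the origin is irrelevant. *)
Definition semialg_uniform : probability (n.-tuple R) R :=
  mnormalize (mrestr (lebesgue_tuple R n) measurable_semialg_set)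
    (dirac (nseq_tuple n (0 : R) : n.-tuple R)).

End basic_semialgebraic.

Section moment_matrices.
Variable R : realType.

Definition psdmx k (A : 'M[R]_k) : Prop :=
  A^T = A /\ forall v : 'rV[R]_k, 0 <= (v *m A *m v^T) 0 0.

Variable r : nat.
Implicit Types (z : multinom r -> R) (h : mpoly r R).

(* bmultinom r d.+1 is the finite type of exponents of total degree at most d. *)
Definition mx_exponent d (i : 'I_#|{: bmultinom r d.+1}|) : multinom r :=
  bmnm (enum_val i).

Definition moment_mx d z : 'M[R]_#|{: bmultinom r d.+1}| :=
  \matrix_(i, j) z (mnm_add (mx_exponent i) (mx_exponent j)).

Definition localizing_mx d h z : 'M[R]_#|{: bmultinom r d.+1}| :=
  \matrix_(i, j) \sum_(c <- msupp h)
    mcoeff c h * z (mnm_add (mnm_add (mx_exponent i) (mx_exponent j)) c).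

End moment_matrices.

(* (a, k) in N^(n+1); the extra variable t comes last, as in mwiden *)
Definition mnm_rcons n (a : multinom n) (k : nat) : multinom n.+1 :=
  Multinom [tuple of rcons a k].

(* The unknown of the program is indexed by exponents of degree at most 2d only.
   Its extension by 0 makes z_(a+b+c) well typed; the constraints read no
   entry of degree above 2d. *)
Definition extend0 (R : realType) r k (z : bmultinom r k -> R) :
  multinom r -> R := fun c => oapp z 0 (insub c).

Section program.
Variables (R : realType) (n m : nat) (g : 'I_m -> mpoly n R).
Variables (y : multinom n -> R) (d : nat).

Definition gprod (b : {ffun 'I_m -> bool}) : mpoly n R :=
  \prod_(j < m) g j ^+ b j.

(* (msize p).-1 is deg p, with deg 0 = 0, and uphalf is ceil(_ / 2) *)
Definition vdeg (b : {ffun 'I_m -> bool}) : nat := uphalf (msize (gprod b)).-1.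

Definition uniform_moment (a : multinom n) : R :=
  \int[semialg_uniform g]_(x in semialg_set g) monomial a x.

Implicit Type z : bmultinom n.+1 (2 * d)%N.+1 -> R.

Record sdp_feasible z : Prop := {
  sdp_moment : psdmx (moment_mx d (extend0 z));
  sdp_localizing : forall b, (vdeg b <= d)%N ->
    psdmx (localizing_mx (d - vdeg b) (mwiden (gprod b)) (extend0 z));
  sdp_marginal : forall a : multinom n, (mdeg a <= 2 * d)%N ->
    extend0 z (mnm_rcons a 0) = uniform_moment a;
  sdp_data : forall a : multinom n, (mdeg (mnm_rcons a 1) <= 2 * d)%N ->
    extend0 z (mnm_rcons a 1) = y a
}.

(* To be minimized over sdp_feasible. The program has no solution when no z is
   feasible, whatever the objective. *)
Definition sdp_objective z : R := \tr (moment_mx d (extend0 z)).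

End program.

Definition representing_measure (R : realType) n (K : set (n.-tuple R))
    (y : multinom n -> R) (mu : {measure set (n.-tuple R) -> \bar R}) : Prop :=
  mu (~` K) = 0%E /\
  forall a, (y a)%:E = (\int[mu]_(x in K) (monomial a x)%:E)%E.

Definition is_density d (T : measurableType d) (R : realType)
    (lam mu : {measure set T -> \bar R}) (f : T -> R) : Prop :=
  forall A, measurable A -> mu A = (\int[lam]_(x in A) (f x)%:E)%E.

(* Main.v *)
Require Import Defs.
From mathcomp Require Import all_boot all_order all_algebra.
From mathcomp.multinomials Require Import -(notations) mpoly.
From mathcomp Require Import all_classical all_reals all_analysis measurable_realfun.
Import Order.TTheory GRing.Theory Num.Theory numFieldNormedType.Exports.
Local Open Scope classical_set_scope.
Local Open Scope ring_scope.

(** The contrapositive is explicit: a density [f] in L_p, with [p >= 2d],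
    produces a feasible point of the program, namely the moments

      z_(alpha, k) = \int_K x^alpha f(x)^k lambda(dx),   |alpha| + k <= 2d,

    that is, the moments of the image of [lambda] under the graph map
    x |-> (x, f x), which lives on K x R.

    The integrals are finite because x^alpha is bounded on the compact set K
    ([compact_monomial_bounded]) and |f|^k <= 1 + |f|^p
    ([Lfun_integrable_exprn]); this is where p >= 2d enters. The moment and
    localizing matrices are then Gram matrices: their quadratic form at [v] is
    the integral over K of h * q^2, where [h] is the (nonnegative) localizing
    polynomial and [q] the polynomial with coefficients [v], evaluated on the
    graph of [f] ([gram_psdmx], [localizing_psdmx]). The entries with k = 0 are
    the moments of [lambda], and those with k = 1 are the integrals of
    x^alpha f against [lambda], which are the moments [y] of the measure with
    density [f] ([integral_density]). *)

(** * Monomials in the variables (x, t) *)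

Lemma monomialD {R : realType} {n} (a b : multinom n) (x : n.-tuple R) :
  monomial (mnm_add a b) x = monomial a x * monomial b x.
Proof.
by rewrite -big_split; apply: eq_bigr => i _; rewrite mnmDE exprD.
Qed.

Lemma monomial_rcons {R : realType} {n} (a : multinom n) k
    (x : n.-tuple R) (t : R) :
  monomial (mnm_rcons a k) [tuple of rcons x t] = monomial a x * t ^+ k.
Proof.
rewrite /monomial big_ord_recr /= /mnm_rcons multinomE.
congr (_ * _ ^+ _).
- apply: eq_bigr => i _; rewrite !multinomE !(tnth_nth (0 : R)) !(tnth_nth 0%N) /=.
  by rewrite !nth_rcons !size_tuple ltn_ord -mnm_nth.
- by rewrite (tnth_nth (0 : R)) nth_rcons size_tuple ltnn eqxx.
- by rewrite (tnth_nth 0%N) nth_rcons size_tuple ltnn eqxx.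
Qed.

Lemma mnm_rcons_surj {n} (c : multinom n.+1) :
  exists a k, c = mnm_rcons a k.
Proof.
exists (Multinom [tuple c (widen_ord (leqnSn n) i) | i < n]), (c ord_max).
apply/mnmP => i; rewrite /mnm_rcons multinomE (tnth_nth 0%N) nth_rcons size_tuple.
case: ltnP => [ltin|lein].
  rewrite -[nat_of_ord i]/(nat_of_ord (Ordinal ltin)) -tnth_nth tnth_mktuple.
  by congr (c _); exact: val_inj.
have -> : i = ord_max by apply/val_inj/eqP; rewrite eqn_leq -ltnS ltn_ord.
by rewrite eqxx.
Qed.

Lemma mdeg_rcons {n} (a : multinom n) k :
  mdeg (mnm_rcons a k) = (mdeg a + k)%N.
Proof.
rewrite !mdegE big_ord_recr /= /mnm_rcons multinomE; congr (_ + _)%N.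
  apply: eq_bigr => i _; rewrite !multinomE !(tnth_nth 0%N) /=.
  by rewrite nth_rcons size_tuple ltn_ord -mnm_nth.
by rewrite (tnth_nth 0%N) nth_rcons size_tuple ltnn eqxx.
Qed.

Lemma meval_mwiden {R : realType} {n} (p : mpoly n R) (x : n.-tuple R) (t : R) :
  meval (tnth [tuple of rcons x t]) (mwiden p) = meval (tnth x) p.
Proof.
rewrite (mwidenE (leqnn (msize p))) [in RHS](mpolywE (leqnn (msize p))).
rewrite !raddf_sum /=; apply: eq_bigr => c _; rewrite !mevalZ !mevalX.
by congr (_ * _); have := monomial_rcons c 0 x t; rewrite expr0 mulr1.
Qed.

Lemma msize_mwiden_le {R : realType} {n} (p : mpoly n R) :
  (msize (mwiden p) <= msize p)%N.
Proof.
rewrite [in leqLHS](mwidenE (leqnn (msize p))).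
apply: (leq_trans (msize_sum _ _ _)).
apply/bigmax_leqP => c _; apply: (leq_trans (msizeZ_le _ _)).
rewrite msizeX; have := bmdeg c.
by rewrite -[mnmwiden c]/(mnm_rcons c 0) mdeg_rcons addn0.
Qed.

(** * Integrals of finite sums *)

Section finite_sums.
Context {d} {T : measurableType d} {R : realType} (mu : {measure set T -> \bar R}).
Context (D : set T) (mD : measurable D).
Context (I : eqType) (s : seq I) (h : I -> T -> R).
Hypothesis h_int : {in s, forall i, mu.-integrable D (EFin \o h i)}.

(* Outside [s] the terms are replaced by 0, so that the whole family becomes
   integrable without changing the sum. *)
Let h' i := if i \in s then EFin \o h i else cst 0%E.

Let h'_int i : mu.-integrable D (h' i).
Proof.
by rewrite /h'; case: ifPn => [/h_int//|_]; exact: integrable0.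
Qed.

Let sum_h' x : (\sum_(i <- s) h i x)%:E = (\sum_(i <- s) h' i x)%E.
Proof.
by rewrite -sumEFin; apply: eq_big_seq => i si; rewrite /h' si.
Qed.

Lemma integrable_sum_seq :
  mu.-integrable D (EFin \o (fun x => \sum_(i <- s) h i x)).
Proof.
have -> : EFin \o (fun x => \sum_(i <- s) h i x) =
    (fun x => \sum_(i <- s) h' i x)%E by apply/funext.
exact: integrable_sum.
Qed.

Lemma Rintegral_sum :
  \int[mu]_(x in D) (\sum_(i <- s) h i x) = \sum_(i <- s) \int[mu]_(x in D) h i x.
Proof.
rewrite /Rintegral; under eq_integral do rewrite sum_h'.
rewrite integral_sum// -sum_fine; last by move=> i _; exact: integrable_fin_num.
by apply: eq_big_seq => i si; rewrite /h' si.
Qed.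

End finite_sums.

(** * Positive semidefiniteness of moment and localizing matrices *)

Section moments_of_a_map.
Context {d} {T : measurableType d} {R : realType} (mu : {measure set T -> \bar R}).
Context (D : set T) (mD : measurable D).

(** The quadratic form of this matrix at [v] is the integral over [D] of
    [w * (\sum_i v_i phi_i) ^+ 2]. *)
Lemma gram_psdmx k (w : T -> R) (phi : 'I_k -> T -> R) :
  (forall x, D x -> 0 <= w x) ->
  (forall i j, mu.-integrable D (EFin \o (fun x => w x * (phi i x * phi j x)))) ->
  psdmx (\matrix_(i, j) \int[mu]_(x in D) (w x * (phi i x * phi j x))).
Proof.
move=> w0 wint; split.
  apply/matrixP => i j; rewrite !mxE; apply: eq_Rintegral => x _.
  by rewrite [phi j x * _]mulrC.
move=> v.
have -> : (v *m (\matrix_(i, j) \int[mu]_(x in D) (w x * (phi i x * phi j x)))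
    *m v^T) 0 0 =
    \int[mu]_(x in D) (w x * (\sum_i v 0 i * phi i x) ^+ 2).
  transitivity (\sum_(ij : 'I_k * 'I_k) \int[mu]_(x in D)
      (v 0 ij.1 * v 0 ij.2 * (w x * (phi ij.1 x * phi ij.2 x)))).
    rewrite -(pair_bigA _ (fun i j => \int[mu]_(x in D)
      (v 0 i * v 0 j * (w x * (phi i x * phi j x))))) /= exchange_big /=.
    rewrite mxE; apply: eq_bigr => j _; rewrite !mxE big_distrl /=.
    apply: eq_bigr => i _; rewrite mxE RintegralZl//.
    by rewrite mulrAC.
  rewrite -Rintegral_sum//.
    apply: eq_Rintegral => x _.
    rewrite -(pair_bigA _ (fun i j =>
      v 0 i * v 0 j * (w x * (phi i x * phi j x)))) /=.
    rewrite expr2 big_distrl /= big_distrr /=; apply: eq_bigr => i _.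
    rewrite big_distrr /= big_distrr /=; apply: eq_bigr => j _.
    by rewrite mulrCA; congr (_ * _); rewrite mulrACA.
  by move=> ij _; exact (integrableZl mD (v 0 ij.1 * v 0 ij.2) (wint ij.1 ij.2)).
by apply: Rintegral_ge0 => x Dx; rewrite mulr_ge0 ?w0 ?sqr_ge0.
Qed.

(* The integrals of [monomial c (phi x)] are the moments of the image under
   [phi] of the restriction of [mu] to [D]. *)
Context (r N : nat) (phi : T -> r.-tuple R).
Hypothesis phi_int : forall c : multinom r, (mdeg c <= N)%N ->
  mu.-integrable D (EFin \o (fun x => monomial c (phi x))).

(** The entry (i, j) is the integral of [h * e_i * e_j] along [phi], where
    [e_i] is the [i]-th monomial of degree at most [k], so the matrix is a Gram
    matrix with weight [h]. The degree condition ensures that all monomials of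
    [h * e_i * e_j] have degree at most [N], where [z] is a moment sequence. *)
Lemma localizing_psdmx (z : multinom r -> R) (h : mpoly r R) (k : nat) :
  (forall c, (mdeg c <= N)%N -> z c = \int[mu]_(x in D) monomial c (phi x)) ->
  (2 * k + (msize h).-1 <= N)%N ->
  (forall x, D x -> 0 <= meval (tnth (phi x)) h) ->
  psdmx (localizing_mx k h z).
Proof.
move=> zE hN h0.
pose e (i : 'I_#|{: bmultinom r k.+1}|) : multinom r := mx_exponent i.
have eN i j c : c \in msupp h -> (mdeg (mnm_add (mnm_add (e i) (e j)) c) <= N)%N.
  move=> /msize_mdeg_lt ch; rewrite !mdegD (leq_trans _ hN)// mul2n -addnn.
  rewrite !leq_add//; try by rewrite -ltnS; exact: bmdeg.
  by rewrite -ltnS (leq_trans ch)// leqSpred.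
have hE i j x : meval (tnth (phi x)) h * (monomial (e i) (phi x) * monomial (e j) (phi x)) =
    \sum_(c <- msupp h) mcoeff c h * monomial (mnm_add (mnm_add (e i) (e j)) c) (phi x).
  rewrite mevalE big_distrl /=; apply: eq_bigr => c _.
  rewrite !monomialD -mulrA; congr (_ * _); exact: mulrC.
have hint i j : {in msupp h, forall c, mu.-integrable D (EFin \o (fun x =>
    mcoeff c h * monomial (mnm_add (mnm_add (e i) (e j)) c) (phi x)))}.
  move=> c ch.
  exact (integrableZl mD (mcoeff c h) (phi_int _ (eN i j c ch))).
have -> : localizing_mx k h z = \matrix_(i, j) \int[mu]_(x in D)
    (meval (tnth (phi x)) h * (monomial (e i) (phi x) * monomial (e j) (phi x))).
  apply/matrixP => i j; rewrite !mxE; under eq_Rintegral do rewrite hE.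
  rewrite Rintegral_sum//; apply: eq_big_seq => c ch.
  by rewrite zE ?eN// RintegralZl//; exact: phi_int _ (eN _ _ _ ch).
apply: gram_psdmx => // i j; under [_ \o _]eq_fun do rewrite /= hE.
exact: integrable_sum_seq.
Qed.

Lemma moment_mxE (z : multinom r -> R) k : moment_mx k z = localizing_mx k 1 z.
Proof.
apply/matrixP => i j; rewrite !mxE msupp1 big_seq1 mcoeff1 eqxx mul1r.
by rewrite addm0.
Qed.

End moments_of_a_map.

(** * Bounds, integrability and densities *)

Lemma measurable_monomial {R : realType} {n} (a : multinom n) :
  measurable_fun [set: n.-tuple R] (monomial a).
Proof.
by apply: measurable_prod => i _; apply: measurable_funX; exact: measurable_tnth.
Qed.

(** Each coordinate is continuous, hence bounded on the compact set [K], and a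
    monomial is a product of powers of coordinates. *)
Lemma compact_monomial_bounded {R : realType} {n} {K : set (n.-tuple R)}
    (a : multinom n) :
  compact (@row_of_tuple R n @` K) -> [bounded monomial a x | x in K].
Proof.
move=> cK.
have coord_bounded i : exists M, forall x, K x -> `|tnth x i| <= M.
  have [M [_ KM]] : bounded_set ((fun v : 'rV[R]_n => v 0 i) @`
      (@row_of_tuple R n @` K) : set R^o).
    apply/compact_bounded/continuous_compact => //.
    exact/continuous_subspaceT/coord_continuous.
  (* [M] bounds only through the numbers strictly above it. *)
  exists (M + 1) => x Kx; apply: (KM (M + 1)); first by rewrite ltrDl.
  exists (row_of_tuple x); first by exists x.
  by rewrite mxE.
have [M KM] := choice coord_bounded.
exists (\prod_(i < n) M i ^+ a i); split=> [|C /ltW MC x Kx]; first exact: num_real.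
rewrite /= (le_trans _ MC)// normr_prod ler_prod// => i _.
by rewrite normr_ge0 normrX lerXn2r ?nnegrE ?normr_ge0 ?(le_trans _ (KM i x Kx)) ?KM.
Qed.

(** The two summands bound [t ^+ k] for [t <= 1] and for [1 <= t] respectively. *)
Lemma exprn_le_powR {R : realType} (t p : R) k :
  0 <= t -> 1 <= p -> k%:R <= p -> t ^+ k <= 1 + t `^ p.
Proof.
move=> t0 p1 kp; have [t1|/ltW t1] := leP t 1.
  by rewrite (le_trans (exprn_ile1 k t0 t1))// lerDl powR_ge0.
rewrite -powR_mulrn// (le_trans (_ : _ <= t `^ p)) ?lerDr//.
by rewrite ler_powR.
Qed.

Section finite_measure.
Context {d} {T : measurableType d} {R : realType}.

(** A finite measure integrates 1, so [1 + |f| `^ p] is an integrable bound of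
    [|f| ^+ k]. *)
Lemma Lfun_integrable_exprn (mu : {finite_measure set T -> \bar R})
    (f : T -> R) (p : R) (k : nat) :
  1 <= p -> k%:R <= p -> f \in Lfun mu p%:E ->
  mu.-integrable [set: T] (fun x => (f x ^+ k)%:E).
Proof.
move=> p1 kp fp.
have mf : measurable_fun [set: T] f by have /andP[/set_mem] := fp.
have int_bound : mu.-integrable [set: T] (fun x => (1 + `|f x| `^ p)%:E).
  exact (integrableD measurableT (finite_measure_integrable_cst mu 1 measurableT)
    (Lfun_integrable p1 fp)).
apply: le_integrable int_bound => //.
  exact/measurable_EFinP/measurable_funX.
move=> x _ /=; rewrite lee_fin normrX.
by rewrite [leRHS]ger0_norm ?addr_ge0 ?powR_ge0// exprn_le_powR.
Qed.

(** A density of [mu] agrees almost everywhere with the Radon-Nikodym derivative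
    of [mu], for which the change of variables formula holds. In particular [f]
    may be negative on a null set. *)
Lemma integral_density (lam mu : {finite_measure set T -> \bar R}) (f : T -> R)
    (D : set T) (h : T -> \bar R) :
  measurable_fun [set: T] f -> is_density lam mu f ->
  measurable D -> mu.-integrable D h ->
  (\int[mu]_(x in D) h x = \int[lam]_(x in D) (h x * (f x)%:E))%E.
Proof.
move=> mf muf mD hint.
have mu_lam : mu `<< lam.
  apply/null_content_dominatesP => A mA lamA0; rewrite muf//.
  by rewrite null_set_integral//; exact/measurable_EFinP/measurable_funTS.
have RNf : ae_eq lam D (Radon_Nikodym (charge_of_finite_measure mu) lam) (EFin \o f).
  apply: integral_ae_eq => //.
  - by apply: (integrableS measurableT) => //; exact: Radon_Nikodym_integrable.
  - exact/measurable_EFinP/measurable_funTS.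
  - move=> A _ mA; rewrite -Radon_Nikodym_integral//; exact: muf.
rewrite -(Radon_Nikodym_change_of_variables mu_lam)//.
have mh := measurable_int _ hint.
apply: ae_eq_integral => //.
- by apply: emeasurable_funM => //; exact: measurable_funTS.
- by apply: emeasurable_funM => //; exact/measurable_EFinP/measurable_funTS.
- exact: ae_eqe_mul2l.
Qed.

End finite_measure.

(** * The moments of the graph of a density *)

Lemma extend0E {R : realType} {r k : nat} (L : multinom r -> R) (c : multinom r) :
  (mdeg c <= k)%N -> extend0 (fun b : bmultinom r k.+1 => L (bmnm b)) c = L c.
Proof. by rewrite -ltnS => ck; rewrite /extend0 insubT. Qed.

Section density_feasible.
Context {R : realType} {n m : nat} (g : 'I_m -> mpoly n R).
Let K := semialg_set g.
Let lam := semialg_uniform g.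
Context (f : n.-tuple R -> R) (p : R) (d : nat).
Hypotheses (cK : compact (@row_of_tuple R n @` K)) (p1 : 1 <= p)
  (dp : (2 * d)%N%:R <= p) (fp : f \in Lfun lam p%:E).

Definition graph_point (x : n.-tuple R) : n.+1.-tuple R := [tuple of rcons x (f x)].

Definition graph_moment (c : multinom n.+1) : R :=
  \int[lam]_(x in K) monomial c (graph_point x).

Lemma integrable_graph_monomial (c : multinom n.+1) : (mdeg c <= 2 * d)%N ->
  lam.-integrable K (EFin \o (fun x => monomial c (graph_point x))).
Proof.
have [a [k ->]] := mnm_rcons_surj c; rewrite mdeg_rcons => akd.
under [_ \o _]eq_fun do rewrite /= monomial_rcons.
have mK := measurable_semialg_set g.
have kp : k%:R <= p.
  by rewrite (le_trans _ dp)// ler_nat (leq_trans _ akd)// leq_addl.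
have fk_int := integrableS measurableT mK (@subsetT _ K)
  (Lfun_integrable_exprn lam f p k p1 kp fp).
exact (integrableMr mK (measurable_funTS (measurable_monomial a))
  (compact_monomial_bounded a cK) fk_int).
Qed.

(** The polynomials [gprod g b] are nonnegative on [K] and do not depend on the
    last variable, so their lifts are nonnegative on the graph of [f] over [K],
    and the matrices are positive semidefinite by [localizing_psdmx]. Of [y],
    only the entries of degree below [2 * d] are constrained. *)
Lemma graph_moments_feasible (y : multinom n -> R) :
  (forall a, (mdeg a < 2 * d)%N -> y a = graph_moment (mnm_rcons a 1)) ->
  sdp_feasible g y (fun b : bmultinom n.+1 (2 * d)%N.+1 => graph_moment (bmnm b)).
Proof.
move=> yE.
have mK := measurable_semialg_set g.
have psd := localizing_psdmx lam K mK _ _ graph_point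
  integrable_graph_monomial _ _ _ (extend0E graph_moment).
split.
- rewrite moment_mxE; apply: psd; last by move=> x _; rewrite meval1.
  by rewrite msize1 addn0.
- move=> b bd; apply: psd => [|x Kx].
    (* Entries of this matrix reach degree 2 (d - v) + deg (g^b), and rounding
       up in v >= deg (g^b) / 2 keeps this within 2 d. *)
    have gb_deg : ((msize (mwiden (gprod g b))).-1 <= 2 * vdeg g b)%N.
      rewrite mul2n -leq_uphalf_double uphalf_leq//.
      by rewrite -!subn1 leq_sub2r// msize_mwiden_le.
    by rewrite (leq_trans (leq_add (leqnn _) gb_deg))// -mulnDr subnK.
  rewrite meval_mwiden /gprod rmorph_prod /= prodr_ge0// => j _.
  by rewrite rmorphXn exprn_ge0//; exact: Kx.
- move=> a ad; rewrite extend0E ?mdeg_rcons ?addn0//.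
  by apply: eq_Rintegral => x _; rewrite monomial_rcons expr0 mulr1.
- move=> a ad; rewrite extend0E//; apply/esym/yE.
  by rewrite -addn1 -mdeg_rcons.
Qed.

End density_feasible.

Theorem corollary2p6 (R : realType) (n m : nat) (g : 'I_m -> mpoly n R)
    (y : multinom n -> R) (d : nat) :
  compact (@row_of_tuple R n @` semialg_set g) ->
  (0 < lebesgue_tuple R n (semialg_set g))%E ->
  y (@mnm0 n) = 1 ->
  ~ (exists z : bmultinom n.+1 (2 * d)%N.+1 -> R, sdp_feasible g y z) ->
  forall p : R, 1 <= p -> (2 * d)%N%:R <= p ->
  ~ (exists (mu : {finite_measure set (n.-tuple R) -> \bar R})
            (f : n.-tuple R -> R),
      [/\ representing_measure (semialg_set g) y mu,
          f \in Lfun (semialg_uniform g) p%:E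
        & is_density (semialg_uniform g) mu f]).
Proof.
move=> cK _ _ infeasible p p1 dp [mu [f [[_ ymu] fp muf]]].
apply: infeasible; exists (fun b => graph_moment g f (bmnm b)).
apply: (graph_moments_feasible g f p) => // a _.
have mf : measurable_fun [set: n.-tuple R] f by have /andP[/set_mem] := fp.
have mK := measurable_semialg_set g.
rewrite -[y a]/(fine (y a)%:E) ymu (integral_density (semialg_uniform g) mu f)//.
  congr fine; apply: eq_integral => x _.
  by rewrite monomial_rcons expr1 EFinM.
apply: measurable_bounded_integrable => //.
- rewrite -ge0_fin_numE//; exact: fin_num_measure.
- exact (measurable_funTS (measurable_monomial a)).
- exact: compact_monomial_bounded.
Qed.
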